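(* Let $b,q$ be positive integers, $n=bq$, and fix $x=(1\ 2\ \ldots\ n)\in S_n$. Let $m$ be a divisor of $n$ with $2\le m<n$. Among the elements $y\in S_n$ of cycle type $(b^{q})$, the number $I_m(b,q)$ of those for which $G=\langle x,y\rangle$ is imprimitive with respect to the residue classes modulo $m$ is $$I_m(b,q)=\frac{m!}{b^{q}}\left(\left(\frac{n}{m}\right)!\right)^{m}\sum_{\{(d_i,t_i)\}}\ \prod_{i}\frac{1}{d_i^{t_i}\,t_i!}\left(\frac{d_i^{\frac{d_i q}{m}}}{\left(\frac{d_i q}{m}\right)!}\right)^{t_i},$$ where the sum is taken over all partitions $\{(d_i,t_i)\}$ of $m$ satisfying $$\sum_i d_i t_i=m,\qquad d_i \text{ are all distinct},\qquad d_i\mid b\ \text{ and }\ m\mid d_i q\ \text{ for all } i.$$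
   Context: $S_n$ is the symmetric group on $\{1,\dots,n\}$. A permutation has cycle type $(b^{q})$ if it consists of $q$ disjoint cycles of length $b$. A partition $\{(d_i,t_i)\}$ of $m$ is a finite set of pairs of positive integers, where $d_i$ is a part and $t_i$ its multiplicity, so that $\sum_i d_i t_i=m$. For a group $G$ acting transitively on a set $E$, a nonempty subset $S\subseteq E$ is a block if for each $g\in G$ either $g\cdot S=S$ or $(g\cdot S)\cap S=\emptyset$. ''$G=\langle x,y\rangle$ is imprimitive with respect to the residue classes modulo $m$'' means that the residue classes modulo $m$ in $\{1,\dots,n\}$ form a system of blocks for $G$ (i.e. every element of $G$ permutes these residue classes). *)

(* Defs.v *)
From mathcomp Require Import all_boot all_order all_fingroup all_algebra all_solvable.

Set Implicit Arguments.
Unset Strict Implicit.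
Unset Printing Implicit Defensive.

Import GroupScope.

(* The point i : 'I_n stands for the integer i.+1 of {1, ..., n}. *)

Definition full_cycle (n : nat) : 'S_n := perm (@ordS_inj n).

Definition residue_class (n m r : nat) : {set 'I_n} :=
  [set i : 'I_n | i.+1 == r %[mod m]].

Definition residue_classes (n m : nat) : {set {set 'I_n}} :=
  [set residue_class n m (r : 'I_m) | r : 'I_m].

(* Fixed points are cycles of length 1, and porbits counts them. *)
Definition has_cycle_type (n b q : nat) (y : 'S_n) : bool :=
  (#|porbits y| == q) && [forall C in porbits y, #|C| == b].

(* The partition and cardinality conditions in imprimitivity_system hold
   automatically for m %| n and 1 < m < n; what remains is that every element
   of G permutes the residue classes. *)
Definition residue_imprimitive (n m : nat) (G : {group 'S_n}) : bool :=
  imprimitivity_system G [set: 'I_n] 'P (residue_classes n m).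

Definition I_count (b q m : nat) : nat :=
  #|[set y : 'S_(b * q) | has_cycle_type b q y
       && residue_imprimitive m <<[set full_cycle (b * q); y]>>%G]|.

(* A partition of m is the set of its pairs (part, multiplicity). Bounding both
   entries by m loses nothing: d * t <= m with d, t > 0 forces d, t <= m. *)
Definition is_partition (m : nat) (P : {set 'I_m.+1 * 'I_m.+1}) : bool :=
  [&& [forall p in P, (0 < p.1) && (0 < p.2)],
      [forall p in P, forall p' in P, (p.1 == p'.1) ==> (p == p')]
    & \sum_(p in P) p.1 * p.2 == m]%N.

Definition admissible_partition (b q m : nat) (P : {set 'I_m.+1 * 'I_m.+1})
    : bool :=
  is_partition P && [forall p in P, (p.1 %| b) && (m %| p.1 * q)]%N.

(* Main.v *)
(* A permutation y preserving the residue classes is a pair (s, g): s permutes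
   the m classes and g moves points inside them.  Over a cycle of s of length d,
   the cycles of y have length d times those of the return map of y to one class
   of that cycle.  So y has all cycles of length b iff every return map has all
   cycles of length b / d, and for fixed s the number of such y is a product over
   the cycles of s of a weight w(d).

   Deleting a point from its cycle gives a recurrence for the sum over S_n of the
   products of cycle weights, solved by n! times the coefficient of X^n in
   exp (sum_d w(d) X^d / d), which expands as a sum over partitions of n.  This is
   applied both to S_m and, with w(d) = [d = c], to permutations of a single class
   having all their cycles of length c. *)
Require Import Defs.
From mathcomp Require Import all_boot all_order all_fingroup all_algebra all_solvable.
From mathcomp Require Import ring.
Set Implicit Arguments.
Unset Strict Implicit.
Unset Printing Implicit Defensive.
Import GRing.Theory Num.Theory.
Local Open Scope ring_scope.

(** * Inserting a point into a cycle, and sums of cycle weights *)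

Section CycleInsertion.

Variable T : finType.
Implicit Types (s t : {perm T}) (A : {set T}) (a i x : T).

Lemma mem_porbit_perm s x y : (s y \in porbit s x) = (y \in porbit s x).
Proof. by rewrite -!eq_porbit_mem -{1}(porbit_perm s 1 y) expg1. Qed.

Lemma porbit_fix s a : s a = a -> porbit s a = [set a].
Proof.
move=> sa; apply/setP => x; rewrite inE.
by apply/porbitP/eqP => [[k ->]|->]; [rewrite permX_fix | exists 0%N; rewrite expg0 perm1].
Qed.

Section Insert.

Variables (t : {perm T}) (a i : T).
Hypotheses (ta : t a = a) (ia : i != a).
(** Products act left to right, so [s] sends [i] to [a] and [a] to [t i]: the fixed point [a] of [t]
    is spliced into the cycle of [i], right after [i]. *)
Let s := (tperm a i * t)%g.

Let s_a : s a = t i. Proof. by rewrite permM tpermL. Qed.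
Let s_i : s i = a. Proof. by rewrite permM tpermR. Qed.
Let s_D x : x != a -> x != i -> s x = t x.
Proof. by move=> xa xi; rewrite permM tpermD // eq_sym. Qed.

Let porbit_a x : x != a -> a \notin porbit t x.
Proof. by rewrite porbit_sym porbit_fix ?inE. Qed.

Lemma porbit_insert : porbit s a = a |: porbit t i.
Proof.
apply/eqP; rewrite eqEsubset; apply/andP; split.
  apply/subsetP => _ /porbitP [k ->]; rewrite permX.
  elim: k => [|k IH]; first by rewrite setU11.
  rewrite iterS; move: IH; set y := iter k s a => IH.
  have [->|ya] := eqVneq y a.
    by rewrite s_a !inE mem_porbit_perm porbit_id orbT.
  have [->|yi] := eqVneq y i; first by rewrite s_i setU11.
  by move: IH; rewrite s_D // !inE (negPf ya) mem_porbit_perm /= => ->; rewrite orbT.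
rewrite subUset sub1set porbit_id /=.
have ai : i \in porbit s a by rewrite -mem_porbit_perm s_i porbit_id.
apply/subsetP => _ /porbitP [k ->]; rewrite permX.
elim: k => [//|k IH]; rewrite iterS; move: IH; set y := iter k t i => IH.
have [->|yi] := eqVneq y i; first by rewrite -s_a mem_porbit_perm porbit_id.
have ya : y != a.
  have: y \in porbit t i by rewrite /y -permX mem_porbit.
  by apply: contraTneq => ->; rewrite porbit_a.
by rewrite -s_D // mem_porbit_perm.
Qed.

Lemma porbit_insert_id x : x \notin a |: porbit t i -> porbit s x = porbit t x.
Proof.
move=> xN.
have E k : iter k s x = iter k t x.
  elim: k => [//|k IH]; rewrite !iterS IH s_D //.
    move: xN; apply: contraNneq => Ea; rewrite !inE; apply/orP; left.
    apply/negPn/negP => xa; move: (porbit_a xa).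
    by rewrite -Ea -permX mem_porbit.
  move: xN; apply: contraNneq => Ei; rewrite !inE; apply/orP; right.
  by rewrite porbit_sym -Ei -permX mem_porbit.
by apply/setP => y; apply/porbitP/porbitP => -[k ->]; exists k; rewrite !permX E.
Qed.

End Insert.

Variables (R : comNzRingType).
Implicit Types u w : nat -> R.

Definition cycle_weight w A s := \prod_(C in [set porbit s x | x in A]) w #|C|.

(** The cycle of the root has its own weight [u]: deleting a point shortens that cycle by one, which
    turns [u] into [u \o S] and leaves [w] on all other cycles. *)
Definition rooted_cycle_weight u w A a s :=
  u #|porbit s a| *
  \prod_(C in [set porbit s x | x in A] :\ porbit s a) w #|C|.

Definition weight_sum w A := \sum_(s | perm_on A s) cycle_weight w A s.

Definition rooted_weight_sum u w A a :=
  \sum_(s | perm_on A s) rooted_cycle_weight u w A a s.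

Lemma weight_sum_rooted w A a : a \in A ->
  weight_sum w A = rooted_weight_sum w w A a.
Proof.
move=> aA; apply: eq_bigr => s _.
by rewrite /cycle_weight (big_setD1 (porbit s a)) ?imset_f.
Qed.

Lemma weight_sum0 w : weight_sum w set0 = 1.
Proof.
rewrite /weight_sum (big_pred1 1%g) => [|s /=].
  by rewrite /cycle_weight imset0 big_set0.
by apply/idP/eqP => [/perm_on_id ->|->]; rewrite ?cards0 ?perm_on1.
Qed.

Lemma rooted_cycle_weight_fix u w A a s : a \notin A -> perm_on A s ->
  rooted_cycle_weight u w (a |: A) a s = u 1%N * cycle_weight w A s.
Proof.
move=> aA sA; have sa := out_perm sA aA.
rewrite /rooted_cycle_weight porbit_fix // cards1; congr (_ * _).
apply: eq_bigl => C; rewrite imsetU1 porbit_fix // setU1K //.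
apply/imsetP => -[x xA /setP/(_ x)]; rewrite porbit_id inE => /eqP xa.
by rewrite xa (negPf aA) in xA.
Qed.

Lemma rooted_cycle_weight_insert u w A a i s :
    a \notin A -> i \in A -> perm_on A s ->
  rooted_cycle_weight u w (a |: A) a (tperm a i * s)%g =
  rooted_cycle_weight (u \o S) w A i s.
Proof.
move=> aA iA sA; have sa := out_perm sA aA.
have ia : i != a by apply: contraNneq aA => <-.
have aNi : a \notin porbit s i by rewrite porbit_sym porbit_fix // inE.
rewrite /rooted_cycle_weight porbit_insert // cardsU1 aNi; congr (_ * _).
apply: eq_bigl => C; rewrite !inE; apply/andP/andP => -[CN /imsetP [x xA EC]].
  have xN : x \notin a |: porbit s i.
    apply: contraNN CN => xi; rewrite EC -(porbit_insert sa ia) eq_porbit_mem.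
    by rewrite porbit_insert.
  have EC' : C = porbit s x by rewrite EC porbit_insert_id.
  split.
    by rewrite EC' eq_porbit_mem; apply: contraNN xN => xi; rewrite inE xi orbT.
  apply/imsetP; exists x => //; move: xA xN; rewrite !inE.
  by case: eqVneq.
have xN : x \notin a |: porbit s i.
  rewrite !inE negb_or; apply/andP; split.
    by apply: contraNneq aA => <-.
  by rewrite -eq_porbit_mem -EC.
have EC' : C = porbit (tperm a i * s)%g x by rewrite EC porbit_insert_id.
split; last by apply/imsetP; exists x => //; rewrite inE xA orbT.
by rewrite EC' -(porbit_insert sa ia) eq_porbit_mem porbit_insert.
Qed.

(* Every permutation s of a |: A is uniquely tperm a i * s' with s' a
   permutation of A, namely for i = s^-1 a: deleting a from its cycle. *)
Lemma rooted_weight_sum_insert u w A a : a \notin A ->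
  rooted_weight_sum u w (a |: A) a =
  u 1%N * weight_sum w A + \sum_(i in A) rooted_weight_sum (u \o S) w A i.
Proof.
move=> aA; rewrite /rooted_weight_sum.
rewrite (partition_big (fun s => s^-1%g a) (mem (a |: A))) /=; last first.
  by move=> s sA; rewrite perm_closed ?setU11 // perm_onV.
have E i : i \in a |: A ->
  \sum_(s | perm_on (a |: A) s && (s^-1%g a == i)) rooted_cycle_weight u w (a |: A) a s
   = \sum_(s | perm_on A s) rooted_cycle_weight u w (a |: A) a (tperm a i * s)%g.
  move=> iA; rewrite (reindex_inj (mulgI (tperm a i))) /=; apply: eq_bigl => s.
  have tA : perm_on (a |: A) (tperm a i).
    apply: subset_trans (tperm_on a i) _.
    by rewrite subUset !sub1set setU11.
  (* Applying [tperm a i * s] to both sides turns the condition on the preimage of [a] into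
     [a == s a]; for [s] supported in [a |: A] this means support in [A]. *)
  rewrite -(inj_eq (@perm_inj _ (tperm a i * s)%g)) permKV permM tpermR.
  apply/andP/idP => [[sA /eqP sa]|sA]; last first.
    rewrite (out_perm sA aA); split=> //; apply: perm_onM => //.
    by apply: subset_trans sA _; rewrite subsetUr.
  have {}sA : perm_on (a |: A) s by rewrite -(tpermKg a i s) perm_onM.
  apply/subsetP => x; rewrite inE => sx; move/subsetP/(_ x): sA; rewrite inE => /(_ sx).
  by rewrite !inE => /orP[/eqP xa|//]; rewrite xa -sa eqxx in sx.
rewrite (eq_bigr _ E) big_setU1 //=; congr (_ + _).
  rewrite big_distrr /=; apply: eq_bigr => s sA.
  by rewrite tperm1 mul1g rooted_cycle_weight_fix.
apply: eq_bigr => i iA; apply: eq_bigr => s sA.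
by rewrite rooted_cycle_weight_insert.
Qed.

End CycleInsertion.

(** * Solving the deletion recurrence *)

Section CycleWeightFormula.

Variables (T : finType) (R : comNzRingType) (w p : nat -> R) (N : nat).
Hypotheses (p0 : p 0 = 1)
  (pS : forall n, (n < N)%N -> p n.+1 *+ n.+1 = \sum_(d < n.+1) w d.+1 * p (n - d)%N).

(** [pS] is the recurrence for the coefficients of exp(sum_d w(d) X^d / d); asking for it only below
    [N] allows truncated series. *)
Lemma weight_sum_formula (A : {set T}) : (#|A| <= N)%N ->
  weight_sum w A = p #|A| *+ #|A|`!.
Proof.
move E: #|A| => n; move: A E.
(* Rooted sums are carried through the induction for every [u], because deletion changes [u]. *)
suff: (forall A : {set T}, #|A| = n -> (n <= N)%N -> weight_sum w A = p n *+ n`!) /\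
   (forall u (A : {set T}) a, a \in A -> #|A| = n.+1 -> (n <= N)%N ->
     rooted_weight_sum u w A a = (\sum_(d < n.+1) u d.+1 * p (n - d)%N) *+ n`!).
  by case.
elim: n => [|n [IH1 IH2]].
  have H0 (A : {set T}) : #|A| = 0%N -> weight_sum w A = 1.
    by move=> /cards0_eq ->; rewrite weight_sum0.
  split=> [A /H0 -> _|u A a aA cA _]; first by rewrite p0.
  have cA' : #|A :\ a| = 0%N by move: cA; rewrite (cardsD1 a) aA => -[].
  rewrite -(setD1K aA) rooted_weight_sum_insert ?setD11 // H0 //.
  by rewrite (cards0_eq cA') big_set0 big_ord1 p0 addr0.
have IH1' (A : {set T}) : #|A| = n.+1 -> (n < N)%N -> weight_sum w A = p n.+1 *+ n.+1`!.
  move=> cA nN; have /set0Pn [a aA] : A != set0 by rewrite -card_gt0 cA.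
  by rewrite (weight_sum_rooted _ aA) IH2 // 1?ltnW // -pS // -mulrnA factS.
split=> // u A a aA cA nN.
have cA' : #|A :\ a| = n.+1 by move: cA; rewrite (cardsD1 a) aA => -[].
rewrite -(setD1K aA) rooted_weight_sum_insert ?setD11 // IH1' //.
(* The term d = 0 is the case where [a] is a fixed point; in the rest, the n+1 choices of [i] give
   equal sums and raise n! to (n+1)!. *)
rewrite big_ord_recl /= subn0 mulrnDl mulrnAr; congr (_ + _).
under eq_bigr => i iA do rewrite IH2 1?ltnW //=.
by rewrite sumr_const cA' -mulrnA mulnC -factS.
Qed.

End CycleWeightFormula.

(** * The exponential generating function, truncated to polynomials *)

Section PartitionSum.

Variables (F : numFieldType) (w : nat -> F) (N : nat).

Definition part_factor (d : nat) : {poly F} :=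
  \sum_(t < N.+1) ((w d / d%:R) ^+ t / (t`!)%:R) *: 'X^(d * t).

Definition part_gf : {poly F} := \prod_(d < N.+1 | d != 0 :> nat) part_factor d.

(* part_factor d truncates the series exp(w(d) X^d / d), whose Euler derivative
   is w(d) X^d times itself. *)
Lemma part_factor_deriv d : (0 < d)%N -> exists r,
  'X * (part_factor d)^`() = w d *: 'X^d * part_factor d + 'X^(N.+1) * r.
Proof.
move=> d0; set c := w d / d%:R.
have dN0 : d%:R != 0 :> F by rewrite pnatr_eq0 -lt0n.
(* The top term t = N of the right-hand product has no partner in the derivative; its degree d + dN
   is at least N+1, so it goes into the remainder. *)
exists (- (w d * (c ^+ N / (N`!)%:R)) *: 'X^(d + d * N - N.+1)).
rewrite -scalerAr -exprD subnKC; last first.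
  by case: d d0 {c dN0} => // d _; rewrite -mulnS leq_pmull.
rewrite /part_factor raddf_sum big_ord_recl big_ord_recr /=.
rewrite muln0 expr0 linearZ /= derivC scaler0 add0r.
rewrite [X in X + _]mulrDr -addrA.
rewrite [X in _ + (X + _)](_ : _ = - (- (w d * (c ^+ N / N`!%:R)) *: 'X^(d + d * N)));
  last first.
  by rewrite -scalerAl -scalerAr scalerA -exprD scaleNr opprK.
rewrite addNr addr0 !big_distrr /=; apply: eq_bigr => t _.
rewrite /bump /= add1n linearZ /= derivXn -scalerAr mulrnAr -exprS prednK ?muln_gt0 ?d0 //.
rewrite -scalerAl -scalerAr -exprD scalerA -mulnS -scaler_nat scalerA; congr (_ *: _).
have t0 : t.+1%:R != 0 :> F by rewrite pnatr_eq0.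
have tf0 : t`!%:R != 0 :> F by rewrite pnatr_eq0 -lt0n fact_gt0.
have -> : w d = c * d%:R by rewrite divfK.
rewrite mulfK // factS !natrM exprS; move: (t.+1%:R : F) t0 => a a0.
by field; rewrite a0 tf0.
Qed.

(** By the Leibniz rule, logarithmic Euler derivatives of the factors add up, modulo X^(N+1). *)
Lemma part_gf_deriv : exists r, 'X * part_gf^`() =
  (\sum_(d < N.+1 | d != 0 :> nat) w d *: 'X^d) * part_gf + 'X^(N.+1) * r.
Proof.
rewrite /part_gf; elim/big_rec2: _ => [|d a A d0 [r IH]].
  by exists 0; rewrite derivC !mulr0 mul0r addr0.
have [|r' E] := @part_factor_deriv d; first by rewrite lt0n.
exists (part_factor d * r + r' * A).
rewrite derivM mulrDr mulrA E mulrCA IH; ring.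
Qed.

Lemma coef_part_gf0 : part_gf`_0 = 1.
Proof.
rewrite -horner_coef0 horner_prod big1 // => d d0.
rewrite horner_sum big_ord_recl big1 /=.
  by rewrite muln0 fact0 divr1 scale1r hornerXn expr0 addr0.
by move=> t _; rewrite hornerZ hornerXn expr0n muln_eq0 (negPf d0) mulr0.
Qed.

(** Compare coefficients of X^(n+1) in [part_gf_deriv]: for n < N the remainder does not reach
    them. *)
Lemma coef_part_gfS n : (n < N)%N ->
  part_gf`_n.+1 *+ n.+1 = \sum_(d < n.+1) w d.+1 * part_gf`_(n - d).
Proof.
move=> nN; have [r /(congr1 (coefp n.+1))] := part_gf_deriv.
rewrite /= coefXM coef_deriv coefD coefXnM ltnS nN addr0 /= => ->.
rewrite mulr_suml coef_sum big_mkcond big_ord_recl /= add0r.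
rewrite (eq_bigr (fun d : 'I_N => if (d < n.+1)%N then w d.+1 * part_gf`_(n - d) else 0)).
  rewrite -big_mkcond /=.
  by rewrite (@big_ord_widen_cond _ _ _ n.+1 N predT (fun d => w d.+1 * part_gf`_(n - d))).
move=> d _; rewrite -scalerAl coefZ coefXnM /bump /= add1n !ltnS subSS.
by case: leqP; rewrite ?mulr0.
Qed.

(** Multiply out: [f d] is the index of the term chosen in the factor of [d]. Forcing [f] to be
    [ord0] at 0, where there is no factor, counts each choice once. *)
Lemma coef_part_gf n : part_gf`_n =
  \sum_(f in pffun_on (ord0 : 'I_N.+1) [pred d : 'I_N.+1 | d != 0 :> nat] predT
          | (\sum_(d < N.+1) d * f d)%N == n)
     \prod_(d < N.+1 | d != 0 :> nat) ((w d / d%:R) ^+ f d / (f d)`!%:R) :> F.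
Proof.
rewrite /part_gf /part_factor (big_distr_big ord0) coef_sum [RHS]big_mkcondr.
apply: eq_bigr => f _; rewrite scaler_prod coefZ prodrXr coefXn.
rewrite [X in _ == X](_ : _ = \sum_(d < N.+1) d * f d)%N; last first.
  rewrite [RHS](bigID (fun d : 'I_N.+1 => d != 0 :> nat)) /= [X in (_ + X)%N]big1 ?addn0 //.
  by move=> d; rewrite negbK => /eqP ->.
by rewrite eq_sym; case: eqP; rewrite ?mulr1 ?mulr0.
Qed.

End PartitionSum.

(** * Partitions as multiplicity functions *)

Section PartitionsAsMultiplicities.

Variable m : nat.
Implicit Types (P : {set 'I_m.+1 * 'I_m.+1}) (f : {ffun 'I_m.+1 -> 'I_m.+1}).

(** A partition is the graph of its multiplicity function, restricted to nonzero values; in the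
    inverse, a size that is not a part gets the default [ord0]. *)
Definition part_of_mult f : {set 'I_m.+1 * 'I_m.+1} :=
  [set (d, f d) | d in [set d | f d != 0 :> nat]].

Definition mult_of_part P : {ffun 'I_m.+1 -> 'I_m.+1} :=
  [ffun d => odflt ord0 [pick t | (d, t) \in P]].

Lemma mem_part_of_mult f p :
  (p \in part_of_mult f) = (f p.1 == p.2) && (p.2 != 0 :> nat).
Proof.
case: p => d t /=; apply/imsetP/andP => [[e]|[/eqP ft t0]].
  by rewrite inE => fe [-> ->].
by exists d; rewrite ?inE ?ft.
Qed.

Lemma big_part_of_mult (R : Type) (idx : R) (op : Monoid.com_law idx)
    (G : 'I_m.+1 * 'I_m.+1 -> R) f :
  \big[op/idx]_(p in part_of_mult f) G p =
  \big[op/idx]_(d | f d != 0 :> nat) G (d, f d).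
Proof.
rewrite big_imset /=; last by move=> d e _ _ [].
by apply: eq_bigl => d; rewrite inE.
Qed.

Lemma part_of_multK : cancel part_of_mult mult_of_part.
Proof.
move=> f; apply/ffunP => d; rewrite ffunE.
case: pickP => [t|/(_ (f d))] /=; rewrite mem_part_of_mult /=.
  by case/andP => /eqP.
by rewrite eqxx /= => /negbFE/eqP f0; apply: val_inj.
Qed.

Lemma mult_of_partK P : is_partition P -> part_of_mult (mult_of_part P) = P.
Proof.
case/and3P => /forall_inP pos /forall_inP dist _; apply/setP => -[d t].
rewrite mem_part_of_mult ffunE /=; case: pickP => [t' Pt'|noP] /=; last first.
  by rewrite noP; apply/negP => /andP[/eqP <-].
apply/andP/idP => [[/eqP <- //]|Pt].
move: (pos _ Pt) => /andP[_ /= t0]; rewrite -lt0n t0.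
by move/forall_inP: (dist _ Pt') => /(_ _ Pt) /=; rewrite eqxx => /eqP [->].
Qed.

(** A graph has distinct parts and its restriction has positive multiplicities; positivity of the
    parts says that [f] vanishes at 0. *)
Lemma is_partition_part_of_mult f :
  is_partition (part_of_mult f) =
  (f \in pffun_on (ord0 : 'I_m.+1) [pred d : 'I_m.+1 | d != 0 :> nat] predT)
  && (\sum_(d < m.+1) d * f d == m)%N.
Proof.
rewrite /is_partition big_part_of_mult andbA; congr (_ && _); last first.
  rewrite [in RHS](bigID (fun d => f d != 0 :> nat)) /=.
  rewrite [X in (_ + X)%N]big1 ?addn0 // => d.
  by rewrite negbK => /eqP ->; rewrite muln0.
apply/andP/pffun_onP => [[/forall_inP pos _]|[f0 _]].
  split=> //; apply/subsetP => d; rewrite !inE => fd.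
  have /pos : (d, f d) \in part_of_mult f by rewrite mem_part_of_mult eqxx.
  by rewrite -lt0n => /andP[].
split.
  apply/forall_inP => -[d t]; rewrite mem_part_of_mult /= => /andP[/eqP <- fd].
  rewrite !lt0n fd andbT; move/subsetP/(_ d): f0; rewrite !inE; exact.
apply/forall_inP => -[d t]; rewrite mem_part_of_mult /= => /andP[/eqP <- _].
apply/forall_inP => -[d' t']; rewrite mem_part_of_mult /= => /andP[/eqP <- _].
by apply/implyP => /eqP ->.
Qed.

Lemma coef_part_gf_partition (F : numFieldType) (w : nat -> F) :
  (part_gf w m)`_m =
  \sum_(P : {set 'I_m.+1 * 'I_m.+1} | is_partition P)
     \prod_(p in P) ((w p.1 / p.1%:R) ^+ p.2 / (p.2)`!%:R).
Proof.
rewrite coef_part_gf [RHS](reindex_onto part_of_mult mult_of_part); last first.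
  exact: mult_of_partK.
apply: eq_big => [f|f]; first by rewrite part_of_multK eqxx andbT is_partition_part_of_mult.
case/andP => /pffun_onP [f0 _] _; rewrite big_part_of_mult.
rewrite (bigID (fun d => f d != 0 :> nat)) /= [X in _ * X]big1 ?mulr1.
  apply: eq_bigl => d; apply: andb_idl => fd.
  move/subsetP/(_ d): f0; rewrite !inE; exact.
by move=> d /andP[_]; rewrite negbK => /eqP ->; rewrite expr0 fact0 divr1.
Qed.

End PartitionsAsMultiplicities.

(** Truncation at [m] is enough, since for [m] points the recurrence is used only below [m]. *)
Lemma weight_sum_partition (T : finType) (m : nat) (F : numFieldType) (w : nat -> F) :
  #|T| = m -> weight_sum w [set: T] = m`!%:R *
  \sum_(P : {set 'I_m.+1 * 'I_m.+1} | is_partition P)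
     \prod_(p in P) ((w p.1 / p.1%:R) ^+ p.2 / (p.2)`!%:R).
Proof.
move=> cT; rewrite -coef_part_gf_partition mulr_natl -cT -cardsT.
apply: (@weight_sum_formula _ _ w (fun n => (part_gf w #|[set: T]|)`_n) #|[set: T]|) => //.
  exact: coef_part_gf0.
by move=> n; apply: coef_part_gfS.
Qed.

(** * Permutations with all cycles of one length *)

Section UniformCycles.

Variables (T : finType) (F : numFieldType).

Definition uniform_cycles (c : nat) : {set {perm T}} :=
  [set s | [forall x, #|porbit s x| == c]].

Lemma card_uniform_cycles c : (0 < c)%N ->
  #|uniform_cycles c|%:R =
  (if (c %| #|T|)%N then #|T|`!%:R / (c%:R ^+ (#|T| %/ c) * (#|T| %/ c)`!%:R)
   else 0) :> F.
Proof.
(* With this [w] the cycle weight is the indicator of all cycles having length [c]; [p] lists the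
   coefficients of exp(X^c / c). *)
move=> c0; pose w (d : nat) := (d == c)%:R : F.
pose p n := (if (c %| n)%N then (c%:R ^+ (n %/ c) * (n %/ c)`!%:R)^-1 else 0) : F.
have -> : #|uniform_cycles c|%:R = weight_sum w [set: T].
  rewrite -sum1_card natr_sum big_mkcond; apply: eq_big => s.
    by symmetry; apply/subsetP => x _; rewrite inE.
  move=> _; rewrite inE /cycle_weight.
  case: forallP => [all|nall].
    by rewrite big1 // => _ /imsetP [x _ ->]; rewrite /w all.
  apply/esym/eqP; apply/prodf_eq0; have /forallPn [x xN] := introN forallP nall.
  by exists (porbit s x); rewrite ?imset_f ?inE // /w (negPf xN) eqxx.
rewrite (@weight_sum_formula _ _ w p #|T|) ?cardsT //.
- by rewrite /p; case: ifP => _; rewrite ?mul0rn // -[LHS]mulr_natl.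
- by rewrite /p /= dvdn0 div0n expr0 fact0 mulr1 invr1.
move=> n _; rewrite (eq_bigr (fun d : 'I_n.+1 =>
    if (d == c.-1 :> nat) then p (n - d)%N else 0)); last first.
  by move=> d _; rewrite /w -{1}(prednK c0) eqSS; case: eqP; rewrite ?mul1r ?mul0r.
(* Only the index d = c-1 survives. If it is out of range, then c > n+1 does not divide n+1 and both
   sides vanish. *)
rewrite -big_mkcond /=; have [cn|nc] := leqP c n.+1; last first.
  rewrite big_pred0; last first.
    by move=> d; apply: ltn_eqF; rewrite (leq_trans (ltn_ord d)) // -ltnS prednK.
  by rewrite /p gtnNdvd // mul0rn.
have cn' : (c.-1 < n.+1)%N by rewrite prednK.
rewrite (big_pred1 (Ordinal cn')) //= /p.
have -> : (n - c.-1 = n.+1 - c)%N by rewrite -[in RHS](prednK c0) subSS.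
rewrite -[X in (c %| X)%N](subnK cn) dvdn_addl //.
case: ifP => [/dvdnP [r Er]|_]; last by rewrite mul0rn.
rewrite Er; have -> : n.+1 = (r.+1 * c)%N by rewrite mulSn -Er addnC subnK.
rewrite !mulnK // -[LHS]mulr_natr exprS factS [(r.+1 * _`!)%:R]natrM natrM.
have cN0 : c%:R != 0 :> F by rewrite pnatr_eq0 -lt0n.
have r0 : r.+1%:R != 0 :> F by rewrite pnatr_eq0.
have rf0 : r`!%:R != 0 :> F by rewrite pnatr_eq0 -lt0n fact_gt0.
have rc0 : c%:R ^+ r != 0 :> F by rewrite expf_neq0.
move: (r.+1%:R : F) r0 => a a0. by field; rewrite a0 cN0 rf0 rc0.
Qed.

End UniformCycles.

(** * Orbit sizes as periods *)

Lemma iter_perm_fix (T : finType) (s : {perm T}) x n :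
  (iter n s x == x) = (#|porbit s x| %| n)%N.
Proof.
set d := #|porbit s x|.
have iterM k : iter (k * d) s x = x.
  by elim: k => // k IH; rewrite mulSn iterD IH iter_porbit.
have d0 : (0 < d)%N by rewrite lt0n card_porbit_neq0.
have rd := ltn_pmod n d0.
rewrite {1}(divn_eq n d) addnC iterD iterM /dvdn.
have -> : (iter (n %% d) s x == x) =
    (nth x (traject s x d) (n %% d) == nth x (traject s x d) 0) by rewrite !nth_traject.
by rewrite nth_uniq ?size_traject ?uniq_traject_porbit.
Qed.

Lemma card_porbit_period (T : finType) (s : {perm T}) x d :
  (forall n, (iter n s x == x) = (d %| n)%N) -> #|porbit s x| = d.
Proof.
move=> H; apply/eqP; rewrite eqn_dvd -iter_perm_fix H dvdnn.
by rewrite -H iter_porbit eqxx.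
Qed.

Lemma card_porbit_conj (T T' : finType) (f : T -> T') (s : {perm T}) (s' : {perm T'}) x :
  injective f -> (forall y, s' (f y) = f (s y)) ->
  #|porbit s' (f x)| = #|porbit s x|.
Proof.
move=> injf H; apply: card_porbit_period => n.
suff -> : iter n s' (f x) = f (iter n s x) by rewrite inj_eq ?iter_perm_fix.
by elim: n => //= n ->; rewrite H.
Qed.

Lemma card_porbit_iter (T : finType) (s : {perm T}) n x :
  #|porbit s (iter n s x)| = #|porbit s x|.
Proof. by rewrite -permX porbit_perm. Qed.

(** * Permutations of a product lying over a permutation of the base *)

Section Wreath.

Variables (T K : finType).
Implicit Types (s : {perm T}) (g : {ffun T -> {perm K}}).

Definition wreath_fun s g (p : T * K) := (s p.1, g p.1 p.2).

Lemma wreath_fun_inj s g : injective (wreath_fun s g).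
Proof. by move=> [i x] [j y] [/perm_inj /= -> /perm_inj ->]. Qed.

Definition wreath s g : {perm T * K} := perm (@wreath_fun_inj s g).

(* Products of permutations act left to right: this is what n steps of
   wreath s g, starting in the fibre over i, do to the second component. *)
Definition holonomy s g n i : {perm K} := (\prod_(l < n) g (iter l s i))%g.

Lemma holonomyS s g n i : holonomy s g n.+1 i = (g i * holonomy s g n (s i))%g.
Proof.
rewrite /holonomy big_ord_recl; congr (_ * _)%g.
by apply: eq_bigr => l _; rewrite iterSr.
Qed.

Lemma iter_wreath s g n i x :
  iter n (wreath s g) (i, x) = (iter n s i, holonomy s g n i x).
Proof.
elim: n i x => [|n IH] i x; first by rewrite /holonomy big_ord0 perm1.
by rewrite iterSr permE /= IH -iterSr holonomyS permM.
Qed.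

(** A return to [(i, x)] needs a return to [i], hence a multiple of the base period d; each round of
    d steps acts on the fibre by the same holonomy, so kd steps act as its k-th power. *)
Lemma card_porbit_wreath s g i x :
  #|porbit (wreath s g) (i, x)| =
  (#|porbit s i| * #|porbit (holonomy s g #|porbit s i| i) x|)%N.
Proof.
apply: card_porbit_period => n; rewrite iter_wreath xpair_eqE iter_perm_fix.
set d := #|porbit s i|; have d0 : (0 < d)%N by rewrite lt0n card_porbit_neq0.
case: (boolP (d %| n)%N) => [/dvdnP [k ->]|dn]; last first.
  by apply/esym/negP => /(dvdn_trans (dvdn_mulr _ (dvdnn d))); apply/negP.
rewrite mulnC dvdn_pmul2l // -iter_perm_fix /=; congr (_ == _).
elim: k {n} => [|k IH]; first by rewrite muln0 /holonomy big_ord0 perm1.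
have := iter_wreath s g (d * k + d) i x.
rewrite addnC iterD !iter_wreath -addnC -mulnSr => -[_ <-] /=.
rewrite IH; congr (holonomy _ _ _ _ _).
by apply/eqP; rewrite iter_perm_fix dvdn_mulr.
Qed.

Section FixedBase.

Variables (s : {perm T}) (b : nat).

(** [pick] sees only the orbit as a set, so it makes the same choice from every point of a cycle and
    marks exactly one root on it. *)
Definition is_root i := [pick j in porbit s i] == Some i.

Lemma is_root_porbit i : exists2 r, r \in porbit s i &
  forall j, j \in porbit s i -> is_root j = (j == r).
Proof.
have [r ri E] : exists2 r, r \in porbit s i & [pick j in porbit s i] = Some r.
  by case: pickP => [r ri|/(_ i)]; [exists r | rewrite porbit_id].
exists r => // j ji.
have Eij : porbit s j = porbit s i by apply/eqP; rewrite eq_porbit_mem.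
by rewrite /is_root Eij E eq_sym.
Qed.

Lemma is_root_inj i j : is_root i -> is_root j -> j \in porbit s i -> j = i.
Proof.
move=> ri rj ji; have [r _ H] := is_root_porbit i.
move: ri rj; rewrite !H ?porbit_id //.
by move=> /eqP -> /eqP ->.
Qed.

Definition return_map g i := holonomy s g #|porbit s i| i.

(** Testing roots suffices: every orbit upstairs passes through the fibre over a root. *)
Lemma uniform_wreathP g :
  reflect (forall i, is_root i ->
             forall x, (#|porbit s i| * #|porbit (return_map g i) x|)%N = b)
    (wreath s g \in uniform_cycles _ b).
Proof.
rewrite inE; apply: (iffP forallP) => [H i _ x|H [i x]].
  by have := H (i, x); rewrite card_porbit_wreath => /eqP.
have [r /porbitP [n rn] Hr] := is_root_porbit i.
rewrite permX in rn.
have rr : is_root r by rewrite Hr ?eqxx // rn -permX mem_porbit.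
rewrite -(card_porbit_iter _ n) iter_wreath -rn card_porbit_wreath.
by apply/eqP/H.
Qed.

Definition straighten g : {ffun T -> {perm K}} :=
  [ffun i => if is_root i then return_map g i else g i].

(* A return map at a root is the value of g there times values of g at
   non-roots, so it can replace that value. *)
Lemma straighten_inj : injective straighten.
Proof.
move=> g g' /ffunP E.
have EN i : ~~ is_root i -> g i = g' i.
  by move=> /negPf iN; have := E i; rewrite !ffunE iN.
apply/ffunP => i; have [ri|] := boolP (is_root i); last exact: EN.
have := E i; rewrite !ffunE ri /return_map.
have: (0 < #|porbit s i|)%N by rewrite lt0n card_porbit_neq0.
case Ed : #|porbit s i| => [//|d] _; rewrite !holonomyS.
(* The remaining factors sit at non-roots, where [g] and [g'] agree: a root among these points would
   be [i] itself, reached in fewer steps than its period. *)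
suff -> : holonomy s g d (s i) = holonomy s g' d (s i) by apply: mulIg.
apply: eq_bigr => l _; rewrite -iterSr; apply: EN; apply/negP => rl.
have := is_root_inj ri rl; rewrite -permX mem_porbit => /(_ isT) /eqP.
by rewrite permX iter_perm_fix Ed gtnNdvd // ltnS.
Qed.

(** Written as a product instead of with length b / d, so that for nonempty [K] the set is empty
    when [d] does not divide [b]. *)
Definition uniform_multiple (d : nat) : {set {perm K}} :=
  [set z | [forall x, (d * #|porbit z x| == b)%N]].

(** [straighten] is an injective self-map of a finite set, hence a bijection, and it decouples the
    conditions: each root value lies in [uniform_multiple], all other values are free. *)
Lemma card_uniform_wreath :
  #|[set g | wreath s g \in uniform_cycles _ b]| =
  (\prod_(C in porbits s) (#|K|`! ^ #|C|.-1 * #|uniform_multiple #|C| |))%N.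
Proof.
pose Q i := [pred z | is_root i ==> (z \in uniform_multiple #|porbit s i|)].
have -> : [set g | wreath s g \in uniform_cycles _ b] =
          straighten @^-1: [set g | g \in family Q].
  apply/setP => g; rewrite [LHS]in_set [RHS]in_set [RHS]in_set.
  apply/uniform_wreathP/familyP => H i.
    rewrite inE /= ffunE; apply/implyP => ri; rewrite ri inE.
    by apply/forallP => x; apply/eqP/H.
  move=> ri x; have := H i; rewrite inE /= ffunE ri inE => /forallP /(_ x).
  by move/eqP.
rewrite (card_preimset _ straighten_inj) cardsE -sum1_card.
have -> : (\sum_(f in family Q) 1 = \prod_i #|Q i|)%N.
  transitivity (\sum_(f in family Q) \prod_(i : T) 1)%N.
    by apply: eq_bigr => f _; rewrite big1.
  rewrite -(bigA_distr_big_dep Q (fun _ _ => 1%N)); apply: eq_bigr => i _.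
  by rewrite sum1_card.
rewrite (partition_big (porbit s) (mem (porbits s))) /=; last first.
  by move=> i _; apply: imset_f.
apply: eq_bigr => _ /imsetP [i _ ->].
have [r ri Hr] := is_root_porbit i.
have Er : porbit s r = porbit s i by apply/eqP; rewrite eq_porbit_mem.
rewrite (bigD1 r) /=; last by rewrite Er.
rewrite mulnC; congr (_ * _)%N; last first.
  by apply: eq_card => z; rewrite inE Hr // eqxx Er.
rewrite (eq_bigr (fun=> #|K|`!)).
  rewrite big_const iter_muln_1; congr (_ ^ _)%N.
  rewrite (cardD1 r (porbit s i)) ri; apply: eq_card => j.
  by rewrite !inE unfold_in eq_porbit_mem andbC.
move=> j /andP[ji jr].
rewrite -[#|K|]cardsT -card_perm; apply: eq_card => z; rewrite inE Hr.
  by rewrite (negPf jr); symmetry; apply/subsetP => x _; rewrite inE.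
by rewrite -eq_porbit_mem.
Qed.

End FixedBase.
End Wreath.

(** * Block-preserving permutations as pairs (s, g) *)

Section BlockPermutations.

Variables (T : finType) (K : finType) (X : finType) (enc : X -> T * K) (dec : T * K -> X).
Hypotheses (encK : cancel enc dec) (decK : cancel dec enc).

Definition preserves_blocks (y : {perm X}) :=
  [forall i, forall j, ((enc i).1 == (enc j).1) ==> ((enc (y i)).1 == (enc (y j)).1)].

Lemma preserves_blocksP (y : {perm X}) : reflect
  (forall i j, (enc i).1 = (enc j).1 -> (enc (y i)).1 = (enc (y j)).1)
  (preserves_blocks y).
Proof.
apply: (iffP forallP) => [H i j /eqP ij|H i].
  by move/forallP/(_ j)/implyP: (H i) => /(_ ij)/eqP.
by apply/forallP => j; apply/implyP => /eqP /H ->.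
Qed.

(** The inverse of [y] is a power of [y], so it preserves blocks as well. *)
Lemma preserves_blocksV (y : {perm X}) i j : preserves_blocks y ->
  (enc (y i)).1 = (enc (y j)).1 -> (enc i).1 = (enc j).1.
Proof.
move=> /preserves_blocksP H E; rewrite -[i](permK y) -[j](permK y) invg_expg !permX.
by elim: #[y]%g.-1 => //= n IH; apply: H.
Qed.

Definition block_fun (p : {perm T} * {ffun T -> {perm K}}) (i : X) : X :=
  dec (wreath p.1 p.2 (enc i)).

Lemma block_fun_inj p : injective (block_fun p).
Proof.
by move=> i j /(can_inj decK)/perm_inj/(can_inj encK).
Qed.

Definition block_perm p : {perm X} := perm (@block_fun_inj p).

Lemma block_perm_dec p t x : block_perm p (dec (t, x)) = dec (p.1 t, p.2 t x).
Proof. by rewrite permE /block_fun decK permE. Qed.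

Lemma block_perm_inj : K -> injective block_perm.
Proof.
move=> x0 [s g] [s' g'] E.
have E' t x : (s t, g t x) = (s' t, g' t x).
  by apply: (can_inj decK); rewrite -(block_perm_dec (s, g)) E block_perm_dec.
congr (_, _); first by apply/permP => t; case: (E' t x0).
by apply/ffunP => t; apply/permP => x; case: (E' t x).
Qed.

(** The base permutation is read off at the point [x0] of each fibre, the inner permutations from
    the second components. *)
Lemma block_perm_onto (y : {perm X}) : K -> preserves_blocks y ->
  exists p, y = block_perm p.
Proof.
move=> x0 yP; have /preserves_blocksP H := yP.
pose s0 t := (enc (y (dec (t, x0)))).1.
have s0_inj : injective s0.
  by move=> t t' /(preserves_blocksV yP); rewrite !decK.
have s0E t x : (enc (y (dec (t, x)))).1 = s0 t by apply: H; rewrite !decK.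
pose g0 t x := (enc (y (dec (t, x)))).2.
have g0_inj t : injective (g0 t).
  move=> x x' E; have: enc (y (dec (t, x))) = enc (y (dec (t, x'))).
    by apply: injective_projections; rewrite ?s0E.
  by move/(can_inj encK)/perm_inj/(can_inj decK) => -[].
exists (perm s0_inj, [ffun t => perm (@g0_inj t)]).
apply/permP => i; rewrite -[i]encK; case: (enc i) => t x.
rewrite block_perm_dec ffunE !permE /= -(s0E t x) -[LHS]encK; congr dec.
exact: surjective_pairing.
Qed.

Lemma preserves_block_perm p : preserves_blocks (block_perm p).
Proof.
apply/preserves_blocksP => i j; rewrite -[i]encK -[j]encK.
by case: (enc i) (enc j) => [t x] [t' x']; rewrite !block_perm_dec !decK => /= ->.
Qed.

Lemma uniform_block_perm p b :
  (block_perm p \in uniform_cycles X b) = (wreath p.1 p.2 \in uniform_cycles _ b).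
Proof.
have E i : #|porbit (block_perm p) (dec i)| = #|porbit (wreath p.1 p.2) i|.
  by apply: (card_porbit_conj _ (can_inj decK)) => -[t x]; rewrite block_perm_dec permE.
rewrite !inE; apply/forallP/forallP => H i; first by rewrite -E.
by rewrite -[i]encK E.
Qed.

Lemma card_uniform_blocks b : (0 < #|K|)%N ->
  #|[set y | preserves_blocks y && (y \in uniform_cycles X b)]| =
  (\sum_(s : {perm T})
    \prod_(C in porbits s) (#|K|`! ^ #|C|.-1 * #|uniform_multiple K b #|C| |))%N.
Proof.
case/card_gt0P => x0 _.
have -> : [set y | preserves_blocks y && (y \in uniform_cycles X b)] =
          block_perm @: [set p | wreath p.1 p.2 \in uniform_cycles _ b].
  apply/setP => y; rewrite in_set; apply/andP/imsetP => [[yP yb]|[p pb ->]].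
    have [p E] := block_perm_onto x0 yP; exists p => //.
    by rewrite in_set -uniform_block_perm -E.
  by rewrite preserves_block_perm uniform_block_perm; rewrite in_set in pb.
rewrite card_imset; last exact: block_perm_inj.
rewrite -sum1_card (eq_bigl (fun p => wreath p.1 p.2 \in uniform_cycles _ b)); last first.
  by move=> p; rewrite in_set.
rewrite -(pair_big_dep xpredT (fun s g => wreath s g \in uniform_cycles _ b)
            (fun _ _ => 1%N)) /=.
apply: eq_bigr => s _; rewrite -card_uniform_wreath -sum1_card.
by apply: eq_bigl => g; rewrite in_set.
Qed.

End BlockPermutations.

(** * Cycle type as uniform orbit size *)

Lemma partition_porbits (T : finType) (y : {perm T}) : partition (porbits y) [set: T].
Proof.
suff -> : porbits y = preim_partition (porbit y) [set: T] by apply: preim_partitionP.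
apply/setP => C; apply/imsetP/imsetP => -[i _ ->]; exists i; rewrite ?inE //;
  by apply/setP => j; rewrite !inE /= eq_porbit_mem porbit_sym.
Qed.

(** Orbits of size [b] partition the bq points, so there are [q] of them. *)
Lemma has_cycle_typeE (n b q : nat) (y : 'S_n) : (0 < b)%N -> n = (b * q)%N ->
  has_cycle_type b q y = (y \in uniform_cycles _ b).
Proof.
move=> b0 nbq; rewrite inE /has_cycle_type.
have -> : [forall C in porbits y, #|C| == b] = [forall x, #|porbit y x| == b].
  apply/forall_inP/forallP => H x; first by apply: H; apply: imset_f.
  by case/imsetP => i _ ->.
apply: andb_idl => /forallP H; rewrite -(eqn_pmul2r b0) eq_sym [(q * b)%N]mulnC -nbq.
rewrite -{1}(card_ord n) -cardsT; apply/eqP.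
apply: card_uniform_partition (partition_porbits y).
by move=> _ /imsetP [i _ ->]; apply/eqP.
Qed.

(** * Residue classes as blocks *)

Section ResidueClasses.

Variables (n m : nat).
Hypotheses (m1 : (1 < m)%N) (mn : (m < n)%N) (dv : (m %| n)%N).

Let m0 : (0 < m)%N. Proof. exact: ltnW. Qed.
Let n0 : (0 < n)%N. Proof. exact: ltn_trans mn. Qed.

Let enc_lt1 (i : 'I_n) : (i %% m < m)%N. Proof. exact: ltn_pmod. Qed.
Let enc_lt2 (i : 'I_n) : (i %/ m < n %/ m)%N. Proof. by rewrite ltn_divLR // divnK. Qed.

(** The index [i] stands for the integer [i.+1], so the block coordinate is the residue shifted by
    one; the classes are the same. *)
Definition residue_enc (i : 'I_n) : 'I_m * 'I_(n %/ m) :=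
  (Ordinal (enc_lt1 i), Ordinal (enc_lt2 i)).

Let dec_lt (p : 'I_m * 'I_(n %/ m)) : (p.2 * m + p.1 < n)%N.
Proof.
apply: (@leq_trans (p.2.+1 * m)); first by rewrite mulSn addnC ltn_add2r.
by rewrite -leq_divRL.
Qed.

Definition residue_dec (p : 'I_m * 'I_(n %/ m)) : 'I_n := Ordinal (dec_lt p).

Lemma residue_encK : cancel residue_enc residue_dec.
Proof. by move=> i; apply: val_inj; rewrite /= -divn_eq. Qed.

Lemma residue_decK : cancel residue_dec residue_enc.
Proof.
move=> [t x]; congr (_, _); apply: val_inj => /=.
  by rewrite modnMDl modn_small.
by rewrite divnMDl // (divn_small (ltn_ord t)) addn0.
Qed.

Lemma residue_enc1 i j :
  ((residue_enc i).1 == (residue_enc j).1) = (i.+1 == j.+1 %[mod m]).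
Proof. by rewrite -val_eqE /= -(addn1 i) -(addn1 j) eqn_modDr. Qed.

Lemma residue_classes_preim :
  residue_classes n m = preim_partition (fun i => (residue_enc i).1) [set: 'I_n].
Proof.
have E (i : 'I_n) r : i.+1 = r %[mod m] ->
    [set j in [set: 'I_n] | (residue_enc i).1 == (residue_enc j).1] = residue_class n m r.
  by move=> ir; apply/setP => j; rewrite !inE residue_enc1 ir eq_sym.
apply/setP => C; apply/imsetP/imsetP => [[r _ ->]|[i _ ->]].
  (* The index of an integer congruent to [r]; adding [m] first keeps the predecessor meaningful
     when [r] is 0. *)
  have lt : ((r + m).-1 %% m < n)%N by apply: leq_trans (ltn_pmod _ m0) (ltnW mn).
  exists (Ordinal lt); rewrite ?inE //; symmetry; apply: E => /=.
  by rewrite -addn1 modnDml addn1 prednK ?modnDr // addn_gt0 m0 orbT.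
exists (Ordinal (ltn_pmod i.+1 m0)); rewrite ?inE //.
by apply: E; rewrite /= modn_mod.
Qed.

Lemma card_residue_classes : #|residue_classes n m| = m.
Proof.
rewrite card_in_imset ?card_ord // => r r' _ _ /setP E.
have lt : ((r + m).-1 %% m < n)%N by apply: leq_trans (ltn_pmod _ m0) (ltnW mn).
move: (E (Ordinal lt)); rewrite !inE /= -addn1 modnDml addn1 prednK; last first.
  by rewrite addn_gt0 m0 orbT.
rewrite modnDr eqxx !modn_small // => /esym/eqP; exact: val_inj.
Qed.

(** The wrap-around modulo [n] is invisible modulo [m], as [m] divides [n]. *)
Lemma preserves_residue_full_cycle : preserves_blocks residue_enc (full_cycle n).
Proof.
apply/preserves_blocksP => i j [ij]; apply: val_inj; rewrite !permE /=.
by rewrite !modn_dvdm // -addn1 -modnDml ij modnDml addn1.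
Qed.

(** Stabilising the set of classes can be tested on the two generators, and the full cycle always
    passes. *)
Lemma residue_imprimitiveE (y : 'S_n) :
  residue_imprimitive m <<[set full_cycle n; y]>>%G = preserves_blocks residue_enc y.
Proof.
rewrite /residue_imprimitive /imprimitivity_system residue_classes_preim.
rewrite preim_partitionP -residue_classes_preim card_residue_classes cardsT card_ord m1 mn.
rewrite /= gen_subG subUset !sub1set.
have E z : (z \in 'N(residue_classes n m | 'P^* )%g) = preserves_blocks residue_enc z.
  rewrite residue_classes_preim !inE /=.
  apply/subsetP/preserves_blocksP => [H i j ij|H C].
    set C := [set k in [set: 'I_n] | (residue_enc i).1 == (residue_enc k).1].
    have /H : C \in preim_partition (fun i => (residue_enc i).1) [set: 'I_n].
      by apply: imset_f; rewrite inE.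
    rewrite inE /= => /imsetP [k _ E].
    have zC l : l \in C -> (residue_enc k).1 = (residue_enc (z l)).1.
      move=> lC; suff : z l \in setact 'P C z by rewrite E inE in_setT => /eqP.
      by apply/imsetP; exists l.
    by apply: etrans (esym (zC i _)) (zC j _); rewrite inE in_setT ?ij /=.
  case/imsetP => i _ ->; rewrite inE; apply/imsetP; exists (z i); rewrite ?inE //.
  apply/setP => j; rewrite [RHS]inE in_setT /=; apply/imsetP/eqP => [[k]|].
    by rewrite !inE => /eqP ik ->; apply: H.
  move=> ij; exists ((z^-1)%g j); last by rewrite /= apermE permKV.
  rewrite !inE; apply/eqP/(@preserves_blocksV _ _ _ residue_enc z); last by rewrite permKV.
  by apply/preserves_blocksP.
by rewrite !E preserves_residue_full_cycle andbT.
Qed.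

End ResidueClasses.

(** * Evaluating the count *)

Lemma I_countE (b q m : nat) : (0 < b)%N -> (1 < m)%N -> (m < b * q)%N -> (m %| b * q)%N ->
  I_count b q m =
  (\sum_(s : 'S_m) \prod_(C in porbits s)
     ((b * q %/ m)`! ^ #|C|.-1 * #|uniform_multiple 'I_(b * q %/ m) b #|C| |))%N.
Proof.
move=> b0 m1 mn dv.
have := card_uniform_blocks (residue_encK m1 dv) (residue_decK m1 dv) b.
rewrite card_ord => <-; last by rewrite divn_gt0 ?(ltnW mn) // ltnW.
apply: eq_card => y; rewrite !in_set (residue_imprimitiveE m1 mn dv).
by rewrite (has_cycle_typeE _ b0) // andbC in_set.
Qed.
(** With c = b/d the cycles have length c. From |K| m = c d q, c divides |K| exactly when m divides
    dq, and there are dq/m cycles; c is then rewritten as b/d. *)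
Lemma card_uniform_multiple (F : numFieldType) (K : finType) (b q m d : nat) :
    (0 < b)%N -> (0 < m)%N -> (0 < d)%N -> (0 < #|K|)%N -> (#|K| * m = b * q)%N ->
  #|uniform_multiple K b d|%:R =
  (if (d %| b)%N && (m %| d * q)%N then
     #|K|`!%:R * (d%:R ^+ (d * q %/ m) / (d * q %/ m)`!%:R) / b%:R ^+ (d * q %/ m)
   else 0) :> F.
Proof.
move=> b0 m0 d0 K0 Km; have [/dvdnP [c Eb]|ndb] := boolP (d %| b)%N; last first.
  rewrite (_ : uniform_multiple K b d = set0) ?cards0 //.
  apply/setP => z; rewrite !inE; apply/negP => /forallP H.
  have /card_gt0P [x _] := K0.
  by case/negP: ndb; rewrite -(eqP (H x)) dvdn_mulr.
have c0 : (0 < c)%N by move: b0; rewrite Eb muln_gt0 => /andP[].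
have -> : uniform_multiple K b d = uniform_cycles K c.
  apply/setP => z; rewrite !inE; apply: eq_forallb => x.
  by rewrite Eb mulnC eqn_pmul2r.
have Kdq : (#|K| * m = c * (d * q))%N by rewrite Km Eb mulnA.
rewrite card_uniform_cycles // /=.
rewrite -(dvdn_pmul2r m0) Kdq dvdn_pmul2l //.
case: ifP => [/dvdnP [e Ee]|//].
have EK : #|K| = (e * c)%N.
  by apply/eqP; rewrite -(eqn_pmul2r m0) Kdq Ee; apply/eqP; ring.
rewrite Ee mulnK // {2 3}EK mulnK // Eb natrM exprMn.
have dN0 : d%:R ^+ e != 0 :> F by rewrite expf_neq0 // pnatr_eq0 -lt0n.
have cN0 : c%:R ^+ e != 0 :> F by rewrite expf_neq0 // pnatr_eq0 -lt0n.
have fN0 : e`!%:R != 0 :> F by rewrite pnatr_eq0 -lt0n fact_gt0.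
by field; rewrite dN0 cN0 fN0.
Qed.

Theorem theorem3p5 (b q m : nat) (hb : (0 < b)%N) (hq : (0 < q)%N)
    (hmn : (m %| b * q)%N) (hm2 : (2 <= m)%N) (hmlt : (m < b * q)%N) :
  (I_count b q m)%:R =
    (m`!)%:R / b%:R ^+ q * ((b * q %/ m)`!)%:R ^+ m *
    \sum_(P : {set 'I_m.+1 * 'I_m.+1} | admissible_partition b q P)
      \prod_(p in P)
        let d := nat_of_ord p.1 in
        let t := nat_of_ord p.2 in
        1 / (d%:R ^+ t * (t`!)%:R) *
        (d%:R ^+ (d * q %/ m) / ((d * q %/ m)`!)%:R) ^+ t :> rat.
Proof.
have m0 : (0 < m)%N by apply: ltnW.
set k := (b * q %/ m)%N.
have k0 : (0 < k)%N by rewrite divn_gt0 // ltnW.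
have km : (k * m = b * q)%N by rewrite divnK.
pose w d : rat := (k`! ^ d.-1 * #|uniform_multiple 'I_k b d|)%:R.
have wE d : (0 < d)%N -> w d =
    if (d %| b)%N && (m %| d * q)%N then
     k`!%:R ^+ d * (d%:R ^+ (d * q %/ m) / (d * q %/ m)`!%:R) / b%:R ^+ (d * q %/ m)
    else 0.
  move=> d0; rewrite /w natrM (@card_uniform_multiple _ _ b q m) ?card_ord //.
  case: ifP => _; last by rewrite mulr0.
  have -> : k`!%:R ^+ d = k`!%:R ^+ d.-1 * k`!%:R :> rat by rewrite -exprSr prednK.
  by rewrite natrX !mulrA.
rewrite I_countE // -/k.
(* The product over the cycles of [s] is its cycle weight for [w], so the partition formula applies
   to S_m. *)
transitivity (weight_sum w [set: 'I_m]).
  rewrite natr_sum; apply: eq_big => [s|s _].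
    by symmetry; apply/subsetP => x _; rewrite inE.
  rewrite natr_prod; apply: eq_bigl => C.
  by apply/imsetP/imsetP => -[x _ ->]; exists x; rewrite ?inE.
rewrite (weight_sum_partition _ (card_ord m)) -!mulrA; congr (_ * _).
rewrite mulrA big_distrr /= /admissible_partition [RHS]big_mkcondr /=.
apply: eq_bigr => P /and3P [/forall_inP pos _ /eqP sumP].
(* An inadmissible part has weight 0 and positive multiplicity, so its partition contributes
   nothing. *)
case: ifPn => [/forall_inP adm|/forall_inPn [p pP padm]]; last first.
  apply/eqP/prodf_eq0; exists p => //; have /andP [p1 p2] := pos p pP.
  by rewrite wE // (negPf padm) mul0r expr0n eqn0Ngt p2 mul0r.
(* Multiply by [m], which divides each dq: the sum of dtq is mq. This distributes b^q over the
   parts, as the sum of dt being [m] does for the m-th power of k!. *)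
have sum_q : (\sum_(p in P) (p.1 * q %/ m) * p.2 = q)%N.
  apply/eqP; rewrite -(eqn_pmul2r m0) big_distrl /= mulnC -[X in (_ == X * _)%N]sumP.
  rewrite big_distrl /=; apply/eqP/eq_bigr => p /adm/andP[_ dv].
  by rewrite -mulnA [(p.2 * m)%N]mulnC mulnA divnK // mulnAC.
have -> : k`!%:R ^+ m = \prod_(p in P) k`!%:R ^+ (p.1 * p.2) :> rat.
  by rewrite prodrXr sumP.
have -> : b%:R ^+ q = \prod_(p in P) b%:R ^+ (p.1 * q %/ m * p.2) :> rat.
  by rewrite prodrXr sum_q.
rewrite -prodfV -!big_split /=.
apply: eq_bigr => p pP; have /andP [p1 p2] := pos p pP.
rewrite wE // adm // !exprM !exprMn !exprVn.
move: (k`!%:R ^+ _ ^+ _) (b%:R ^+ _ ^+ _) => A B.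
by rewrite invfM; ring.
Qed.
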